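(* For every $l\in\mathbb N$, the $l$-th spectral curve $\Gamma_l:=\{(\lambda,\mu)\in\mathbb C^2: P_l(\lambda,\mu^2)=0\}$ is an irreducible complex algebraic curve.
   Context: For $l\in\mathbb N$ and $\mu\in\mathbb C$, $H_l$ is the tridiagonal $l\times l$ matrix with entries $H_{l;jj}=(1-j)(l-j+1)$, $H_{l;j,j+1}=\mu j$, $H_{l;j,j-1}=\mu(l-j+1)$, and $H_{l;ij}=0$ if $|i-j|\geq 2$. It is known that $\det(H_l+\lambda\,\mathrm{Id})$ is a polynomial of degree $l$ in $(\lambda,\mu^2)$; it is written $P_l(\lambda,\mu^2)$. *)

(* Defs.v *)
From HB Require Import structures.
From mathcomp Require Import all_boot all_order all_algebra.
From mathcomp Require Import reals.
From mathcomp Require Import complex.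
Set Implicit Arguments. Unset Strict Implicit. Unset Printing Implicit Defensive.
Import Order.TTheory GRing.Theory Num.Theory.
Local Open Scope ring_scope.

(* The l x l tridiagonal matrix H_l(mu).  Rows/columns are indexed by
   i : 'I_l, corresponding to the paper's index j = i + 1. Hence
   H_{jj} = (1-j)(l-j+1) = -(i * (l - i)),
   H_{j,j+1} = mu * j = mu * (i+1),
   H_{j,j-1} = mu * (l-j+1) = mu * (l - i). *)
Definition Hmat (C : comNzRingType) (l : nat) (mu : C) : 'M[C]_l :=
  \matrix_(i < l, j < l)
    if i == j then - ((i * (l - i))%N)%:R
    else if (j : nat) == i.+1 then mu * (i.+1)%:R
    else if (i : nat) == j.+1 then mu * ((l - i)%N)%:R
    else 0.

(* P_l(lambda, mu^2) = det(H_l(mu) + lambda Id) *)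
Definition Pl_eval (C : comNzRingType) (l : nat) (lam mu : C) : C :=
  \det (Hmat l mu + lam%:M).

Definition spectral_curve (C : comNzRingType) (l : nat) : C * C -> Prop :=
  fun p => Pl_eval l p.1 p.2 = 0.

Definition eval2 (C : comNzRingType) (p : {poly {poly C}}) (a b : C) : C :=
  (p.[b%:P]).[a].

(* Irreducibility of a subset V of C^2 (an algebraic set): V is nonempty
   and its vanishing ideal I(V) in C[x,y] is prime. *)
Definition irreducible_set (C : comNzRingType) (V : C * C -> Prop) : Prop :=
  (exists p, V p) /\
  forall f g : {poly {poly C}},
    (forall p, V p -> eval2 (f * g) p.1 p.2 = 0) ->
    (forall p, V p -> eval2 f p.1 p.2 = 0) \/
    (forall p, V p -> eval2 g p.1 p.2 = 0).

(* Main.v *)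
(* With N and N' the super- and subdiagonal parts of H at mu = 1, one has
   H - mu^2 = - (mu - N') (mu - N), a product of triangular matrices, so that
   P(- mu^2, mu) = (- mu^2)^l.  Since P has total degree l and is monic in
   lambda of degree l, a factor of lambda-degree d > 0 has total degree d, hence
   restricts to a nonconstant polynomial on the parabola (- x^2, x); this
   restriction divides a power of x, so the factor vanishes at (0, 0).  But
   lambda = 0 is a simple root of P(lambda, 0) = \prod_i (lambda - i (l - i)),
   so P cannot have two such factors.  Irreducibility of P in C[mu][lambda]
   yields primality of the vanishing ideal by a Bezout relation over C(mu). *)

Require Import Defs.
From HB Require Import structures.
From mathcomp Require Import all_boot all_order all_algebra.
From mathcomp Require Import reals.
From mathcomp Require Import complex.
From mathcomp Require Import zify.
Import GRing.Theory Num.Theory.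
Local Open Scope ring_scope.
Local Open Scope complex_scope.

(** * Determinant identities for P *)

(** Makes each change of variables in the polynomial determinant a substitution in its two
    arguments. *)
Lemma Pl_eval_rmorph (A B : comNzRingType) (f : {rmorphism A -> B}) (l : nat) (lam mu : A) :
  f (Pl_eval l lam mu) = Pl_eval l (f lam) (f mu).
Proof.
rewrite /Pl_eval -det_map_mx map_mxD map_scalar_mx; congr (\det (_ + _)).
apply/matrixP => i j; rewrite !mxE /=.
case: ifP => _; first by rewrite rmorphN /= rmorph_nat.
case: ifP => _; first by rewrite rmorphM /= rmorph_nat.
by case: ifP => _; rewrite ?rmorph0 // rmorphM /= rmorph_nat.
Qed.

Lemma Pl_eval_neg_sqr (C : comNzRingType) (l : nat) (mu : C) :
  Pl_eval l (- mu ^+ 2) mu = (- mu ^+ 2) ^+ l.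
Proof.
(* [U] is mu - N and [L] is mu - N'. *)
pose U : 'M[C]_l := \matrix_(i, j)
  (mu *+ (i == j) - (i.+1)%:R *+ ((j : nat) == i.+1)).
pose L : 'M[C]_l := \matrix_(i, j)
  (mu *+ (i == j) - (l - i)%:R *+ ((i : nat) == j.+1)).
have detU : \det U = mu ^+ l.
  rewrite -det_tr det_trig; last first.
    apply/is_trig_mxP => i j ltij; rewrite !mxE -val_eqE /= gtn_eqF //.
    by rewrite ltn_eqF ?subr0 // ltnW.
  under eq_bigr => i _ do rewrite !mxE eqxx ltn_eqF // subr0.
  by rewrite prodr_const card_ord.
have detL : \det L = mu ^+ l.
  rewrite det_trig; last first.
    apply/is_trig_mxP => i j ltij; rewrite !mxE -val_eqE /= ltn_eqF //.
    by rewrite ltn_eqF ?subr0 // ltnW.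
  under eq_bigr => i _ do rewrite !mxE eqxx ltn_eqF // subr0.
  by rewrite prodr_const card_ord.
suff -> : Pl_eval l (- mu ^+ 2) mu = \det ((-1) *: (L *m U)).
  by rewrite detZ det_mulmx detU detL -!exprMn mulN1r expr2.
rewrite /Pl_eval; congr (\det _); apply/matrixP => i j; rewrite !mxE.
(* Row i of [L] is supported on columns i - 1 and i; the first row only has the diagonal entry. *)
have [i0|i_gt0] := posnP i.
  rewrite (bigD1 i) //= big1 => [|k ki]; last first.
    by rewrite !mxE eq_sym (negPf ki) i0 subr0 mul0r.
  rewrite !mxE eqxx -!val_eqE /= i0 /= mul0n !mulr0n oppr0 !addr0 mulr1n.
  have [j0|] := eqVneq 0%N (j : nat).
    by rewrite -j0 /= mulr1n mulr0n subr0 mulN1r add0r expr2.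
  rewrite !mulr0n addr0 mulN1r sub0r mulrN opprK => _.
  by case: eqP => _; rewrite ?mulr1n ?mulr0n ?mulr0.
have lti : (i.-1 < l)%N by rewrite (leq_ltn_trans (leq_pred i)).
pose i' := Ordinal lti.
have i'i : i' != i by rewrite -val_eqE /= neq_ltn prednK ?leqnn.
rewrite (bigD1 i) //= (bigD1 i') ?i'i //= big1 => [|k /andP[ki ki']]; last first.
  rewrite !mxE eq_sym (negPf ki) sub0r (_ : (i == k.+1 :> nat) = false) ?oppr0 ?mul0r //.
  by apply: contraNF ki' => /eqP e; rewrite -val_eqE /= e.
rewrite !mxE !eqxx [i == i']eq_sym (negPf i'i) /= prednK // eqxx (ltn_eqF (ltnSn i)).
rewrite subr0 sub0r addr0 !mulr1n -!val_eqE /=.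
have [eij|nij] := eqVneq (i : nat) j.
  rewrite -eij (ltn_eqF (ltnSn i)) ltn_eqF ?prednK // !mulr1n !mulr0n subr0 sub0r.
  by rewrite mulrNN mulN1r opprD natrM addrC expr2 [_ * i%:R]mulrC.
rewrite !mulr0n oppr0 !addr0 sub0r.
have [eji|nji] := eqVneq (j : nat) i.+1.
  rewrite eji ltn_eqF ?prednK // ?leqW // !mulr0n mulr0 addr0 mulr1n.
  by rewrite mulN1r mulrN opprK.
rewrite mulr0n oppr0 mulr0 add0r -[in LHS](prednK i_gt0) eqSS prednK //.
by case: eqP => _; rewrite ?mulr1n ?mulr0n ?mulr0 // mulN1r mulNr opprK mulrC.
Qed.

Lemma Pl_eval_mu0 (C : comNzRingType) (l : nat) (lam : C) :
  Pl_eval l lam 0 = \prod_(i < l) (lam - (i * (l - i))%:R).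
Proof.
rewrite /Pl_eval det_trig.
  by apply: eq_bigr => i _; rewrite !mxE !eqxx mulr1n addrC.
apply/is_trig_mxP => i j ltij; rewrite !mxE -val_eqE ltn_eqF //= !mul0r.
by rewrite !if_same addr0.
Qed.

(** * P as a polynomial in lambda over C[mu], and its total degree *)

Lemma size_det_linear (R : comNzRingType) (n : nat) (M : 'M[{poly R}]_n) :
  (forall i j, (size (M i j) <= 2)%N) -> (size (\det M) <= n.+1)%N.
Proof.
move=> sM; apply: leq_trans (size_sum _ _ _) _; apply/bigmax_leqP => s _.
rewrite mulr_sign (fun_if (fun p : {poly R} => size p)) size_polyN if_same.
apply: leq_trans (size_prod_leq _ _) _; rewrite card_ord leq_subLR addnS ltnS.
by rewrite addnn -muln2 -[in leqRHS](card_ord n) -sum_nat_const leq_sum.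
Qed.

(* The outer variable is lambda and the inner one mu, the reverse of [eval2]. *)
Definition spectral_poly (C : comNzRingType) (l : nat) : {poly {poly C}} :=
  Pl_eval l 'X 'X%:P.

(** Yields monicity and the degree in lambda from the general facts on characteristic
    polynomials. *)
Lemma spectral_poly_char (C : comNzRingType) (l : nat) :
  spectral_poly C l = char_poly (- Hmat l 'X).
Proof.
rewrite /spectral_poly /Pl_eval /char_poly /char_poly_mx addrC; congr (\det (_ + _)).
apply/matrixP => i j; rewrite !mxE.
rewrite polyCN opprK; by do ?[case: ifP => _]; rewrite ?polyCN ?polyCM ?rmorph_nat.
Qed.

Lemma spectral_poly_monic (C : comNzRingType) (l : nat) :
  spectral_poly C l \is monic.
Proof. by rewrite spectral_poly_char char_poly_monic. Qed.

Lemma size_spectral_poly (C : comNzRingType) (l : nat) :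
  size (spectral_poly C l) = l.+1.
Proof. by rewrite spectral_poly_char size_char_poly. Qed.

Lemma horner_spectral_poly (C : comNzRingType) (l : nat) (p : {poly C}) :
  (spectral_poly C l).[p] = Pl_eval l p 'X.
Proof.
by rewrite -/(horner_eval p _) Pl_eval_rmorph /= /horner_eval hornerX hornerC.
Qed.

Lemma map_spectral_poly (C : comNzRingType) (l : nat) (mu : C) :
  map_poly (horner_eval mu) (spectral_poly C l) = Pl_eval l 'X mu%:P.
Proof.
by rewrite Pl_eval_rmorph /= map_polyX map_polyC /= /horner_eval hornerX.
Qed.

Lemma horner2_spectral_poly (C : comNzRingType) (l : nat) (lam mu : C) :
  (spectral_poly C l).[lam%:P].[mu] = Pl_eval l lam mu.
Proof.
rewrite horner_spectral_poly -/(horner_eval mu _) Pl_eval_rmorph /=.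
by rewrite /horner_eval hornerC hornerX.
Qed.

(* F(lambda, mu) becomes F(s x, x): the degree in x is the total degree of F. *)
Definition homog (C : comNzRingType) (F : {poly {poly C}}) : {poly {poly C}} :=
  horner_eval ('X%:P * 'X) (map_poly (map_poly (@polyC C)) F).

(** A monomial lambda^i mu^j becomes s^i x^(i + j), so distinct monomials never collide. *)
Lemma coef_homog (C : comNzRingType) (F : {poly {poly C}}) (n i : nat) :
  (homog C F)`_n`_i = if (i <= n)%N then F`_i`_(n - i) else 0.
Proof.
rewrite /homog /horner_eval (@horner_coef_wide _ (maxn (size F) i.+1)); last first.
  by rewrite (leq_trans (size_poly _ _)) // leq_maxl.
rewrite coef_sum coef_sum.
have lti : (i < maxn (size F) i.+1)%N by rewrite leq_max ltnSn orbT.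
have E (k : 'I_(maxn (size F) i.+1)) :
    (((map_poly (map_poly (@polyC C)) F)`_k * ('X%:P * 'X) ^+ k)`_n)`_i =
    (if (k <= n)%N then F`_k`_(n - k) else 0) *+ (i == k :> nat).
  rewrite exprMn -rmorphXn /= mulrA coefMXn ltnNge; case: leqP => _ /=.
    by rewrite coefMC !coef_map /= coefCM coefXn mulr_natr.
  by rewrite coef0 mul0rn.
rewrite (eq_bigr _ (fun k _ => E k)) (bigD1 (Ordinal lti)) //= eqxx mulr1n.
by rewrite big1 ?addr0 // => k ki; rewrite eq_sym (negPf (ki : k != i :> nat)).
Qed.

(** After lambda = s x and mu = x, every entry of H + lambda Id has degree at most 1 in x. *)
Lemma size_homog_spectral_poly (C : comNzRingType) (l : nat) :
  (size (homog C (spectral_poly C l)) <= l.+1)%N.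
Proof.
rewrite /homog !Pl_eval_rmorph /= map_polyX map_polyC /= map_polyX.
rewrite /horner_eval hornerX hornerC.
apply: size_det_linear => i j; rewrite !mxE.
have h (c : nat) : (size ('X * c%:R : {poly {poly C}})%R <= 2)%N.
  by rewrite mulr_natr -scaler_nat (leq_trans (size_scale_leq _ _)) ?size_polyX.
have hs : (size (('X%:P * 'X) *+ (i == j) : {poly {poly C}})%R <= 2)%N.
  case: eqP => _; rewrite ?size_poly0 // mulr1n mul_polyC.
  by rewrite (leq_trans (size_scale_leq _ _)) ?size_polyX.
apply: leq_trans (size_polyD _ _) _; rewrite geq_max hs andbT.
case: ifP => _; first by rewrite size_polyN -polyC_natr (leq_trans (size_polyC_leq1 _)).
by do 2![case: ifP => // _]; rewrite size_poly0.
Qed.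

Lemma homogM (C : comNzRingType) (F G : {poly {poly C}}) :
  homog C (F * G) = homog C F * homog C G.
Proof. by rewrite /homog !rmorphM. Qed.

(** * Gauss's lemma for C[mu][lambda] *)

(** Induction on the degree of [c]: at a root a of [c] the product [A * B] vanishes modulo mu - a.
    As C[lambda] is a domain, mu - a divides all coefficients of [A] or all those of [B], and
    cancels against [c]. *)
Lemma gauss_factor (C : closedFieldType) (c : {poly C}) (P A B : {poly {poly C}}) :
  c != 0 -> c *: P = A * B -> exists A' B', P = A' * B' /\ A' %= A.
Proof.
have [n] := ubnP (size c); elim: n => // n IHn in c A B *.
rewrite ltnS => sc c0 eqP_.
have [/size_poly1P [k k0 ck]|/closed_rootP [a rca]] := boolP (size c == 1%N).
  exists ((k^-1)%:P *: A), B; split.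
    by rewrite -scalerAl -eqP_ ck scalerA -polyCM mulVf // scale1r.
  by rewrite eqp_scale // polyC_eq0 invr_eq0.
have /factor_theorem [d cd] := rca.
have d0 : d != 0 by apply: contraNneq c0 => d0; rewrite cd d0 mul0r.
have Xa0 : 'X - a%:P != 0 by rewrite polyXsubC_eq0.
have X0 : ('X - a%:P)%:P != 0 :> {poly {poly C}} by rewrite polyC_eq0.
have sd : (size d < n)%N.
  by rewrite (leq_trans _ sc) // cd size_Mmonic ?monicXsubC // size_XsubC addn2.
have divX (D : {poly {poly C}}) : map_poly (horner_eval a) D = 0 ->
    exists D', D = ('X - a%:P) *: D'.
  move=> D0; exists (\poly_(i < size D) (D`_i %/ ('X - a%:P))).
  apply/polyP => i; rewrite coefZ coef_poly.
  case: ltnP => [_|/leq_sizeP -> //]; last by rewrite mulr0.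
  rewrite mulrC divpK // dvdp_XsubCl; apply/rootP.
  by rewrite -/(horner_eval a _) -coef_map D0 coef0.
have : map_poly (horner_eval a) A * map_poly (horner_eval a) B = 0.
  by rewrite -rmorphM /= -eqP_ linearZ /= /horner_eval (rootP rca) scale0r.
move/eqP; rewrite mulf_eq0 => /orP [] /eqP /divX [D eD].
  have [|A' [B' [PAB eA']]] := IHn d D B sd d0.
    by apply: (mulfI X0); rewrite !mul_polyC scalerA [_ * d]mulrC -cd eqP_ eD scalerAl.
  by exists A', B'; split=> //; rewrite eD (eqp_trans eA') // eqp_sym eqp_scale.
have [|A' [B' [PAB eA']]] := IHn d A D sd d0; last by exists A', B'.
by apply: (mulfI X0); rewrite !mul_polyC scalerA [_ * d]mulrC -cd eqP_ eD scalerAr.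
Qed.

(** * Irreducibility of P *)

(* A total degree equal to the degree in lambda makes (- x^2)^d the only term of degree 2 d. *)
Lemma size_parabola_gt1 (C : idomainType) (A : {poly {poly C}}) (d : nat) :
  (0 < d)%N -> size A = d.+1 -> (size (homog C A) <= d.+1)%N ->
  (1 < size A.[- 'X^2])%N.
Proof.
move=> d_gt0 sA shA.
have totdeg (i j : nat) : (d < i + j)%N -> A`_i`_j = 0.
  move=> ltd; have := coef_homog C A (i + j) i.
  rewrite leq_addr addKn => <-.
  by rewrite [(homog C A)`_ _]nth_default ?coef0 // (leq_trans shA).
suff coefd : (A.[- 'X^2])`_(d.*2) != 0.
  rewrite (leq_ltn_trans _ (_ : d.*2 < _)%N) ?double_gt0 //.
  by rewrite ltnNge; apply: contraNN coefd => h; rewrite nth_default.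
rewrite horner_coef sA coef_sum big_ord_recr /= big1 => [|i _].
  rewrite add0r exprNn -exprM mulrCA -signr_odd mulr_sign (fun_if (fun p : {poly C} => p`_(d.*2))).
  rewrite coefN coefMXn -muln2 mulnC ltnn subnn.
  (* The total degree bound forces the leading coefficient of [A] to be constant in mu. *)
  suff h : A`_d`_0 != 0 by case: ifP; rewrite ?oppr_eq0.
  have: lead_coef A != 0 by rewrite lead_coef_eq0 -size_poly_eq0 sA.
  rewrite lead_coefE sA /= => ld; apply: contraNneq ld => ld0.
  by apply/eqP/polyP => -[|j]; rewrite coef0 // totdeg // addnS ltnS leq_addr.
rewrite exprNn -exprM mulrCA -signr_odd mulr_sign (fun_if (fun p : {poly C} => p`_(d.*2))).
(* The contributing monomial lambda^i mu^(2 d - 2 i) has total degree 2 d - i > d. *)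
rewrite coefN coefMXn totdeg; first by rewrite if_same oppr0 if_same.
by have := ltn_ord i; lia.
Qed.

Lemma spectral_poly_indecomposable (C : numClosedFieldType) (l : nat)
    (A B : {poly {poly C}}) :
  spectral_poly C l = A * B -> (size A == 1%N) || (size B == 1%N).
Proof.
move=> PAB; have P0 : spectral_poly C l != 0 by rewrite monic_neq0 ?spectral_poly_monic.
have [A0 B0] : A != 0 /\ B != 0.
  by apply/andP; rewrite -negb_or -mulf_eq0 -PAB.
apply/norP => -[sA1 sB1].
have [a sA a_gt0] : exists2 a, size A = a.+1 & (0 < a)%N.
  by move: A0 sA1; rewrite -size_poly_eq0; case: (size A) => [|[|n]] // _ _; exists n.+1.
have [b sB b_gt0] : exists2 b, size B = b.+1 & (0 < b)%N.
  by move: B0 sB1; rewrite -size_poly_eq0; case: (size B) => [|[|n]] // _ _; exists n.+1.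
have lab : l = (a + b)%N.
  by have := size_mul A0 B0; rewrite -PAB size_spectral_poly sA sB; lia.
have /andP [uA uB] : (lead_coef A \is a GRing.unit) && (lead_coef B \is a GRing.unit).
  by rewrite -unitrM -lead_coefM -PAB (monicP (spectral_poly_monic _ _)) unitr1.
(* A unit leading coefficient is a nonzero constant, so the monomial lambda^d survives with total
   degree d. *)
have size_homog_gt (D : {poly {poly C}}) (d : nat) : lead_coef D \is a GRing.unit ->
    size D = d.+1 -> (d < size (homog C D))%N.
  rewrite poly_unitE lead_coefE => /andP [_ uD] sD.
  rewrite sD /= in uD; rewrite ltnNge; apply: contraTN uD => h.
  have := coef_homog C D d d; rewrite leqnn subnn => <-.
  by rewrite [(homog C D)`_ _]nth_default // coef0 unitr0.
have hA := size_homog_gt _ _ uA sA; have hB := size_homog_gt _ _ uB sB.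
(* Total degrees add up to at most a + b, so the lower bounds [hA] and [hB] are equalities. *)
have hAB : (size (homog C A) + size (homog C B) <= (a + b).+2)%N.
  have := size_homog_spectral_poly C l; rewrite PAB homogM lab.
  rewrite size_mul -?size_poly_gt0 ?(leq_ltn_trans _ hA) ?(leq_ltn_trans _ hB) //.
  by rewrite -ltnS; apply: leq_trans (leqSpred _).
(* A nonconstant divisor of a power of - x^2 has a root, which can only be 0. *)
have root0 (D : {poly {poly C}}) : D.[- 'X^2] %| (- 'X^2) ^+ l ->
    (1 < size D.[- 'X^2])%N -> root (map_poly (horner_eval 0) D) 0.
  move=> Ddvd sD; have /closed_rootP [x rx] : size D.[- 'X^2] != 1%N by rewrite gtn_eqF.
  have : root ((- 'X^2) ^+ l) x by rewrite -dvdp_XsubCl (dvdp_trans _ Ddvd) // dvdp_XsubCl.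
  rewrite rootE !hornerE expf_eq0 oppr_eq0 expf_eq0 => /andP [_ /andP [_ /eqP x0]].
  have e0 : horner_eval 0 (- 'X^2) = 0 :> C by rewrite /horner_eval !hornerE expr0n oppr0.
  by rewrite rootE -{2}e0 horner_map /= /horner_eval -rootE -x0.
have eqAB : A.[- 'X^2] * B.[- 'X^2] = (- 'X^2) ^+ l.
  by rewrite -hornerM -PAB horner_spectral_poly Pl_eval_neg_sqr.
have rA : root (map_poly (horner_eval 0) A) 0.
  apply: root0; first by rewrite -eqAB dvdp_mulIl.
  apply: size_parabola_gt1 a_gt0 sA _.
  by rewrite -(leq_add2r (size (homog C B))) (leq_trans hAB) // -addnS -addSn leq_add2l.
have rB : root (map_poly (horner_eval 0) B) 0.
  apply: root0; first by rewrite -eqAB dvdp_mulIr.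
  apply: size_parabola_gt1 b_gt0 sB _.
  by rewrite -(leq_add2l (size (homog C A))) (leq_trans hAB) // -addnS -addSn leq_add2r.
have /factor_theorem [A1 eA] := rA; have /factor_theorem [B1 eB] := rB.
have := map_spectral_poly C l 0; rewrite PAB rmorphM /= eA eB Pl_eval_mu0.
have [l' el] : exists l', l = l'.+1 by exists l.-1; lia.
have X0 : 'X != 0 :> {poly C} by rewrite polyX_eq0.
(* The factor i = 0 is lambda itself. Once it is cancelled, the left side still vanishes at 0,
   whereas i (l - i) is nonzero for 0 < i < l in characteristic 0. *)
rewrite el big_ord_recl /= mul0n !subr0 [A1 * 'X]mulrC -mulrA => /(mulfI X0).
move/(congr1 (fun p => p.[0])); rewrite !hornerM hornerX !mulr0 horner_prod.
move/esym/eqP/prodf_eq0 => [i _].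
rewrite -polyC_natr hornerXsubC sub0r oppr_eq0 pnatr_eq0 muln_eq0 /=.
by rewrite /bump leq0n add1n subSS subn_eq0 leqNgt ltn_ord.
Qed.

(** Divisibility over C[mu] holds only up to a power of the leading coefficient of [Q], that is,
    over C(mu); [gauss_factor] removes this power. *)
Lemma spectral_poly_irreducible (C : numClosedFieldType) (l : nat) :
  (0 < l)%N -> irreducible_poly (spectral_poly C l).
Proof.
move=> l_gt0; split=> [|Q sQ]; first by rewrite size_spectral_poly.
rewrite Pdiv.WeakIdomain.dvdp_eq => /eqP e.
have P0 : spectral_poly C l != 0 by rewrite monic_neq0 ?spectral_poly_monic.
have c0 : lead_coef Q ^+ scalp (spectral_poly C l) Q != 0.
  by rewrite Pdiv.WeakIdomain.lc_expn_scalp_neq0.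
rewrite mulrC in e; have [A [B [PAB eA]]] := gauss_factor _ _ _ _ _ c0 e.
have := spectral_poly_indecomposable C l A B PAB.
rewrite (eqp_size eA) (negPf sQ) /= => /size_poly1P [b b0 eB].
by rewrite eqp_sym in eA; rewrite (eqp_trans eA) // PAB eB mulrC mul_polyC eqp_sym eqp_scale.
Qed.

(** * From irreducibility to primality of the vanishing ideal *)

(* A Bezout relation u P + v F = c(mu) <> 0 excludes common zeros above any b with
   c(b) <> 0. *)
Lemma coprime_nonvanishing (C : numClosedFieldType) (P F : {poly {poly C}}) :
  P \is monic -> (1 < size P)%N -> coprimep P F ->
  exists a b, P.[a%:P].[b] = 0 /\ F.[a%:P].[b] != 0.
Proof.
move=> mP sP /Bezout_coprimepP [[u v] /= ].
rewrite -size_poly_eq1 => /size_poly1P [c c0 ec].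
have /closed_nonrootP [b cb] := c0.
pose at_b := map_poly (horner_eval b).
have atbE (D : {poly {poly C}}) (a : C) : (at_b D).[a] = D.[a%:P].[b].
  by rewrite -[a in LHS](hornerC a b) horner_map.
(* Being monic in lambda, [P] keeps its degree when mu is set to b. *)
have /closed_rootP [a ra] : size (at_b P) != 1%N.
  by rewrite size_map_poly_id0 ?gtn_eqF // (monicP mP) /horner_eval hornerC oner_eq0.
exists a, b; rewrite -!atbE (rootP ra); split=> //.
apply: contraNneq cb => Fab; rewrite rootE.
have := congr1 (fun D => (at_b D).[a]) ec.
rewrite /= /at_b rmorphD !rmorphM /= hornerD !hornerM -/(at_b _) (rootP ra) Fab !mulr0 addr0.
by rewrite /at_b map_polyC hornerC => /esym /eqP.
Qed.

Lemma eval2_swapXY (C : comNzRingType) (f : {poly {poly C}}) (a b : C) :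
  eval2 f a b = (swapXY f).[a%:P].[b].
Proof. by rewrite horner2_swapXY. Qed.

Lemma spectral_poly_dvd_vanishing (C : numClosedFieldType) (l : nat) (f : {poly {poly C}}) :
  spectral_poly C l %| swapXY f ->
  forall p, spectral_curve l p -> eval2 f p.1 p.2 = 0.
Proof.
move=> /(Pdiv.IdomainMonic.dvdpP (spectral_poly_monic C l)) [q fq] [a b] /= Vab.
by rewrite eval2_swapXY fq !hornerM horner2_spectral_poly Vab mulr0.
Qed.

Theorem theorem1p3 (R : realType) (l : nat) (hl : (0 < l)%N) :
  irreducible_set (spectral_curve (C := R[i]) l).
Proof.
split.
  exists (0, 0); rewrite /spectral_curve /= Pl_eval_mu0; apply/eqP/prodf_eq0.
  by exists (Ordinal hl); rewrite //= mul0n subr0.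
move=> f g fgV; pose P := spectral_poly R[i] l.
have [sP irrP] := spectral_poly_irreducible R[i] l hl.
(* By irreducibility, a nonconstant gcd with [P] is associate to [P]. *)
have dvdP (h : {poly {poly R[i]}}) : ~~ coprimep P (swapXY h) -> P %| swapXY h.
  by rewrite coprimep_def => /irrP /(_ (dvdp_gcdl _ _)) e; rewrite -(eqp_dvdl _ e) dvdp_gcdr.
have [/dvdP|] := boolP (~~ coprimep P (swapXY f)).
  by left; apply: spectral_poly_dvd_vanishing.
rewrite negbK => cf.
have [/dvdP|] := boolP (~~ coprimep P (swapXY g)).
  by right; apply: spectral_poly_dvd_vanishing.
rewrite negbK => cg.
(* If [P] is coprime to both factors it is coprime to their product, which is then nonzero at some
   point of the curve, against [fgV]. *)
have [|a [b [Pab]]] := coprime_nonvanishing _ P (swapXY (f * g)) (spectral_poly_monic _ _) sP.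
  by rewrite rmorphM coprimepMr cf cg.
rewrite -eval2_swapXY (fgV (a, b)) ?eqxx // /spectral_curve /=.
by rewrite -horner2_spectral_poly.
Qed.
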